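(* Let $0\le a<b$ and let $f:[a,b]\to\mathbb{R}$, $[a,b]\subset[0,\infty)$, be a differentiable function on $(a,b)$ such that $f'\in L[a,b]$. Let $p,q>1$ with $\frac1p+\frac1q=1$. Suppose that $|f'|^q$ is $s$-convex in the second sense on $[a,b]$ for some fixed $s\in(0,1]$, and that $|f'(x)|\le M$ for all $x\in[a,b]$. Then for every $\alpha>0$ and every $x\in[a,b]$, $$\left|\left(\frac{(x-a)^{\alpha}+(b-x)^{\alpha}}{b-a}\right)f(x)-\frac{\Gamma(\alpha+1)}{b-a}\left[J_{x-}^{\alpha}f(a)+J_{x+}^{\alpha}f(b)\right]\right|$$ $$\le\frac{M}{(1+p\alpha)^{\frac1p}}\left(\frac{2}{s+1}\right)^{\frac1q}\left[\frac{(x-a)^{\alpha+1}+(b-x)^{\alpha+1}}{b-a}\right].$$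
   Context: $L[a,b]$ denotes the space of Lebesgue integrable functions on $[a,b]$. A function $g$ is $s$-convex in the second sense on $[a,b]\subset[0,\infty)$, where $s\in(0,1]$, if $g(\lambda u+(1-\lambda)v)\le\lambda^s g(u)+(1-\lambda)^s g(v)$ for all $u,v\in[a,b]$ and $\lambda\in[0,1]$. The hypotheses on $|f'|$ over the closed interval $[a,b]$ presuppose that $f'$ is defined at the endpoints, as the one-sided derivatives $f'(a)$ and $f'(b)$. $\Gamma(\alpha)=\int_0^\infty e^{-u}u^{\alpha-1}du$ is the Euler Gamma function. The Riemann-Liouville fractional integrals of order $\alpha>0$ appearing here are $J_{x-}^{\alpha}f(a)=\frac{1}{\Gamma(\alpha)}\int_a^x (t-a)^{\alpha-1}f(t)\,dt$ and $J_{x+}^{\alpha}f(b)=\frac{1}{\Gamma(\alpha)}\int_x^b (b-t)^{\alpha-1}f(t)\,dt$ (equal to $0$ when the interval of integration is degenerate). *)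

(* Defs.v *)
From HB Require Import structures.
From mathcomp Require Import all_boot all_order all_algebra.
From mathcomp Require Import all_classical all_reals all_analysis.

Set Implicit Arguments.
Unset Strict Implicit.
Unset Printing Implicit Defensive.

Import Order.TTheory GRing.Theory Num.Theory.
Import numFieldNormedType.Exports.
Local Open Scope classical_set_scope.
Local Open Scope ring_scope.

(* A function on [a, b] is represented by a total function of which only the
   values on [a, b] matter; at the endpoints the derivative is one-sided. *)
Definition is_derivative_cc (R : realType) (a b : R) (f f' : R -> R) : Prop :=
  [/\ forall x, x \in `]a, b[ -> is_derive x 1 f (f' x),
      h^-1 * (f (a + h) - f a) @[h --> 0^'+] --> f' a
    & h^-1 * (f (b + h) - f b) @[h --> 0^'-] --> f' b].

(* s-convexity in the second sense on D, meant for D included in [0, +oo[. *)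
Definition s_convex2 (R : realType) (s : R) (D : set R) (g : R -> R) : Prop :=
  forall u v l : R, D u -> D v -> 0 <= l <= 1 ->
    g (l * u + (1 - l) * v) <= l `^ s * g u + (1 - l) `^ s * g v.

Definition Gamma (R : realType) (alpha : R) : R :=
  \int[lebesgue_measure]_(u in `]0, +oo[) (expR (- u) * u `^ (alpha - 1)).

(* RL_minus alpha x f y is J_{x-}^alpha f(y), for y <= x. *)
Definition RL_minus (R : realType) (alpha x : R) (f : R -> R) (y : R) : R :=
  (Gamma alpha)^-1 *
  \int[lebesgue_measure]_(t in `[y, x]) ((t - y) `^ (alpha - 1) * f t).

(* RL_plus alpha x f y is J_{x+}^alpha f(y), for x <= y. *)
Definition RL_plus (R : realType) (alpha x : R) (f : R -> R) (y : R) : R :=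
  (Gamma alpha)^-1 *
  \int[lebesgue_measure]_(t in `[x, y]) ((y - t) `^ (alpha - 1) * f t).

(* Main.v *)
Require Import Defs.
From HB Require Import structures.
From mathcomp Require Import all_boot all_order all_algebra.
From mathcomp Require Import all_classical all_reals all_analysis.
From mathcomp Require Import measurable_realfun ring lra.

(** The estimate is the elementary remark that a weighted average of [f] near
[x] deviates from [f x] by at most the Lipschitz constant times the average
distance to [x].

Put [w t = (t - a) `^ (alpha - 1)] on the segment from [a] to [x].  Since the
total mass of [w] is [(x - a) `^ alpha / alpha], and since
[Gamma (alpha + 1) = alpha * Gamma alpha] (lemma [GammaD1]), the part of the
left-hand side that lives there is [alpha / (b - a)] times the integral of
[w t * (f x - f t)].  The mean value theorem gives
[`|f x - f t| <= M * (x - t)] ([is_derivative_cc_lipschitz]), and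
[x - t = (x - a) - (t - a)] turns the integral of [w t * (x - t)] into a
difference of two power integrals, equal to
[(x - a) `^ (alpha + 1) / (alpha * (alpha + 1))].  The segment from [x] to [b]
behaves in the same way with the weight [(b - t) `^ (alpha - 1)]; both halves
are instances of [power_weight_deviation].  Adding them bounds the left-hand
side by [M / (alpha + 1)] times the bracket of the right-hand side.

It remains to compare constants.  Young's inequality applied to
[(1 + p * alpha) `^ p^-1] and [1] shows that this root is at most [1 + alpha]
([powR_inv_le1D]), while [2 / (s + 1) >= 1]; hence [1 / (alpha + 1)] is
below the constant of the theorem.

Two improper integrals enter.  The weights are unbounded at an endpoint when
[alpha < 1], so their mass is computed with a version of the fundamental theorem
of calculus on an open interval, [ge0_FTC2_oo].  The functional equation
of [Gamma] comes from Tonelli's theorem, and its finiteness and positivity are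
needed to cancel [Gamma alpha] in the Riemann-Liouville integrals. *)

Set Implicit Arguments.
Unset Strict Implicit.
Unset Printing Implicit Defensive.

Import Order.TTheory GRing.Theory Num.Theory.
Import numFieldNormedType.Exports.
Local Open Scope classical_set_scope.
Local Open Scope ring_scope.

(** * The fundamental theorem of calculus on an open interval *)

(** The integrand may blow up at both ends: nonnegativity replaces
integrability, because the compact intervals that exhaust the open one then have
integrals converging monotonically to the whole one, while the primitive takes
them to the one-sided limits [l] and [m]. *)
Lemma ge0_FTC2_oo (R : realType) (f F : R -> R) (a b l m : R) : a < b ->
  {in `]a, b[, forall t : R, 0 <= f t} ->
  {in `]a, b[, continuous f} ->
  {in `]a, b[, forall t : R, is_derive t 1 F (f t)} ->
  F t @[t --> a^'+] --> l -> F t @[t --> b^'-] --> m ->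
  (\int[lebesgue_measure]_(t in `]a, b[) (f t)%:E = (m - l)%:E)%E.
Proof.
move=> ab f0 cf dF Fl Fm.
(* Denominators start at 2, which makes a + e n < b - e n from n = 0 on. *)
pose e (n : nat) := (b - a) / 2 / n.+2%:R.
have e0 n : 0 < e n by rewrite !divr_gt0// subr_gt0.
have eh n : e n < (b - a) / 2.
  by rewrite ltr_pdivrMr ?ltr_pMr ?ltr1n// divr_gt0// subr_gt0.
have e_nincr n k : (n <= k)%N -> e k <= e n.
  move=> nk; rewrite ler_pM2l ?divr_gt0 ?subr_gt0// lef_pV2 ?posrE//.
  by rewrite ler_nat.
have e_cvg : e n @[n --> \oo] --> 0.
  rewrite -(mulr0 ((b - a) / 2)); apply: cvgM; first exact: cvg_cst.
  by have := @cvg_harmonic R; rewrite -cvg_shiftS.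
have esub n t : t \in `[a + e n, b - e n] -> t \in `]a, b[.
  by have := e0 n; rewrite !in_itv/=; lra.
pose I n : set R := `[a + e n, b - e n]%classic.
have IE : \bigcup_n I n = `]a, b[%classic.
  apply/seteqP; split => [t [n _ /esub//]|t /=].
  rewrite in_itv/= => /andP[at_ tb].
  have : \forall n \near \oo, e n < Num.min (t - a) (b - t).
    by apply: (cvgr_lt 0) => //; rewrite lt_min; apply/andP; split; lra.
  move=> [N _ /(_ N (leqnn N))]; rewrite /= lt_min => /andP[e1 e2].
  by exists N => //; rewrite /I/= in_itv/=; lra.
have IFTC n : (\int[lebesgue_measure]_(t in I n) (f t)%:E =
               (F (b - e n) - F (a + e n))%:E)%E.
  have leI : a + e n < b - e n by have := eh n; lra.
  have cF : {within `[a + e n, b - e n], continuous F}.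
    by apply: derivable_within_continuous => t /esub/dF[].
  rewrite EFinB; apply: continuous_FTC2 => //.
  - by apply: continuous_in_subspaceT => t /set_mem/esub/cf.
  - move/continuous_within_itvP : cF => /(_ leI)[_ ? ?].
    by split => // t /subset_itv_oo_cc/esub/dF[].
  - move=> t /subset_itv_oo_cc/esub/dF dt.
    by rewrite derive1E derive_val.
have lim1 : (\int[lebesgue_measure]_(t in I n) (f t)%:E @[n --> \oo] -->
    \int[lebesgue_measure]_(t in `]a, b[) (f t)%:E)%E.
  rewrite -IE; apply: ge0_nondecreasing_set_cvg_integral => //.
  - move=> n k nk; apply/subsetPset => t.
    have := e_nincr _ _ nk.
    by rewrite /I/= !in_itv/=; lra.
  - by move=> n; exact: measurable_itv.
  - move=> n; apply/measurable_EFinP.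
    apply: (@measurable_funS _ _ _ _ `]a, b[%classic) => //.
      by move=> t; exact: esub.
    by apply: open_continuous_measurable_fun => // t /set_mem/cf.
  - by move=> n t /esub/f0; rewrite lee_fin.
have lim2 : (\int[lebesgue_measure]_(t in I n) (f t)%:E @[n --> \oo] -->
    (m - l)%:E)%E.
  under eq_fun do rewrite IFTC.
  apply: cvg_EFin; first exact: nearW.
  apply: cvgB.
  - move/cvg_at_leftP : Fm; apply; split.
      by move=> n; rewrite ltrBlDr ltrDl.
    by rewrite -[X in _ --> X]subr0; apply: cvgB => //; exact: cvg_cst.
  - move/cvg_at_rightP : Fl; apply; split; first by move=> n; rewrite ltrDl.
    by rewrite -[X in _ --> X]addr0; apply: cvgD => //; exact: cvg_cst.
exact: (cvg_unique _ lim1 lim2).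
Qed.

(** * Integrals of powers and of the exponential *)

Lemma is_derive_powR_subr (R : realType) (r a t : R) : a < t ->
  is_derive t 1 (fun y => (y - a) `^ r) (r * (t - a) `^ (r - 1)).
Proof.
move=> at_; rewrite -[X in is_derive _ _ _ X]mulr1.
apply: (@is_derive1_comp _ (fun y => y `^ r) (fun y => y - a)) => /=.
  by apply: is_derive1_powR; rewrite subr_gt0.
by rewrite -[X in is_derive _ _ _ X]subr0; apply: is_deriveB.
Qed.

Lemma is_derive_powR_rsub (R : realType) (r b t : R) : t < b ->
  is_derive t 1 (fun y => (b - y) `^ r) (- (r * (b - t) `^ (r - 1))).
Proof.
move=> tb; rewrite -[X in is_derive _ _ _ X]mulrN1.
apply: (@is_derive1_comp _ (fun y => y `^ r) (fun y => b - y)).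
  by apply: is_derive1_powR; rewrite subr_gt0.
by rewrite -[X in is_derive _ _ _ X]sub0r; apply: is_deriveB.
Qed.

Lemma is_derive_continuous (R : realType) (f : R -> R) (t df : R) :
  is_derive t 1 f df -> {for t, continuous f}.
Proof. by case=> + _; move=> /derivable1_diffP/differentiable_continuous. Qed.

(** For [r < 1] the integrand is unbounded near [a]; its primitive
[(t - a) `^ r / r] is still continuous there because [r > 0]. *)
Lemma integral_powR_subr (R : realType) (r a b : R) : 0 < r -> a <= b ->
  (\int[lebesgue_measure]_(t in `[a, b]) ((t - a) `^ (r - 1))%:E
   = ((b - a) `^ r / r)%:E)%E.
Proof.
move=> r0; rewrite le_eqVlt => /predU1P[<-|ab].
  by rewrite set_itv1 integral_set1 subrr powR0 ?gt_eqF// mul0r.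
have cf : {in `]a, b[, continuous (fun t => (t - a) `^ (r - 1))}.
  move=> t; rewrite in_itv/= => /andP[at_ _].
  exact: is_derive_continuous (is_derive_powR_subr _ at_).
rewrite integral_itv_bndoo; last first.
  apply/measurable_EFinP; apply: open_continuous_measurable_fun => //.
  by move=> t /set_mem/cf.
rewrite -[X in X%:E]subr0.
pose F := fun t => (t - a) `^ r / r.
have dF t : a < t -> is_derive t 1 F ((t - a) `^ (r - 1)).
  move=> at_; rewrite /F; apply: is_derive_eq.
    apply: is_deriveM; exact: is_derive_powR_subr.
  by rewrite scaler0 add0r /GRing.scale/= mulrA mulVf ?mul1r// gt_eqF.
apply: (@ge0_FTC2_oo _ _ F) => //.
- by move=> t _; exact: powR_ge0.
- by move=> t; rewrite in_itv/= => /andP[at_ _]; exact: dF.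
- rewrite -(mul0r r^-1); apply: cvgM; last exact: cvg_cst.
  apply/cvg_at_rightP => u [ua ucvg].
  have /cvg_at_rightP := powR_cvg0 r0; apply; split.
    by move=> n; rewrite subr_gt0.
  by rewrite -(subrr a); apply: cvgB => //; exact: cvg_cst.
- by have /is_derive_continuous/left_right_continuousP[] := dF _ ab.
Qed.

Lemma integral_powR_rsub (R : realType) (r a b : R) : 0 < r -> a <= b ->
  (\int[lebesgue_measure]_(t in `[a, b]) ((b - t) `^ (r - 1))%:E
   = ((b - a) `^ r / r)%:E)%E.
Proof.
move=> r0; rewrite le_eqVlt => /predU1P[<-|ab].
  by rewrite set_itv1 integral_set1 subrr powR0 ?gt_eqF// mul0r.
have cf : {in `]a, b[, continuous (fun t => (b - t) `^ (r - 1))}.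
  move=> t; rewrite in_itv/= => /andP[_ tb].
  exact: is_derive_continuous (is_derive_powR_rsub _ tb).
rewrite integral_itv_bndoo; last first.
  apply/measurable_EFinP; apply: open_continuous_measurable_fun => //.
  by move=> t /set_mem/cf.
rewrite -[X in X%:E]opprK -[X in X%:E]sub0r.
pose F := fun t => - ((b - t) `^ r / r).
have dF t : t < b -> is_derive t 1 F ((b - t) `^ (r - 1)).
  move=> tb; rewrite /F; apply: is_derive_eq.
    apply: is_deriveN.
    apply: is_deriveM; exact: is_derive_powR_rsub.
  rewrite scaler0 add0r /GRing.scale/= mulrN opprK mulrA.
  by rewrite mulVf ?mul1r// gt_eqF.
apply: (@ge0_FTC2_oo _ _ F) => //.
- by move=> t _; exact: powR_ge0.
- by move=> t; rewrite in_itv/= => /andP[_ tb]; exact: dF.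
- by have /is_derive_continuous/left_right_continuousP[] := dF _ ab.
- rewrite -oppr0 -(mul0r r^-1); apply: cvgN; apply: cvgM; last exact: cvg_cst.
  apply/cvg_at_leftP => u [ub ucvg].
  have /cvg_at_rightP := powR_cvg0 r0; apply; split.
    by move=> n; rewrite subr_gt0.
  by rewrite -(subrr b); apply: cvgB => //; exact: cvg_cst.
Qed.

Lemma integral_expRN_tail (R : realType) (v : R) :
  (\int[lebesgue_measure]_(u in `[v, +oo[) (expR (- u))%:E
   = (expR (- v))%:E)%E.
Proof.
have dF (t : R) : is_derive t 1 (fun u => - expR (- u)) (expR (- t)).
  have dE : is_derive t 1 (fun u => expR (- u)) (expR (- t) * -1).
    exact: (@is_derive1_comp _ expR -%R).
  by apply: is_derive_eq (is_deriveN dE) _; rewrite mulrN1 opprK.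
rewrite (@ge0_continuous_FTC2y _ _ (fun u => - expR (- u)) _ 0).
- by rewrite -EFinB sub0r opprK.
- by move=> t _; exact: expR_ge0.
- apply: continuous_subspaceT => t.
  apply: continuous_comp; [exact: opp_continuous|exact: continuous_expR].
- rewrite -oppr0; apply: cvgN; exact: cvgr_expR.
- by move=> t _; case: (dF t).
- by have /is_derive_continuous/left_right_continuousP[] := dF v.
- by move=> t _; have [_] := dF t; rewrite derive1E.
Qed.

(** * The Gamma function *)

(** The integral defining [Gamma], kept in the extended reals: Tonelli's theorem
applies to it before its finiteness is known, and the finiteness is in
turn deduced from the functional equation. *)
Definition eGamma (R : realType) (alpha : R) : \bar R :=
  (\int[lebesgue_measure]_(u in `]0%R, +oo[)
     (expR (- u) * u `^ (alpha - 1))%:E)%E.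

Lemma measurable_eGamma_integrand (R : realType) (alpha : R) (D : set R) :
  measurable_fun D (fun u : R => (expR (- u) * u `^ (alpha - 1))%:E).
Proof.
apply/measurable_EFinP/measurable_funTS; apply: measurable_funM.
  by apply: measurableT_comp => //; exact: measurable_expR.
exact: measurable_powR.
Qed.

Lemma eGamma_ge0 (R : realType) (alpha : R) : (0 <= eGamma alpha)%E.
Proof.
by apply: integral_ge0 => u _; rewrite lee_fin mulr_ge0 ?expR_ge0 ?powR_ge0.
Qed.

(** Integrate [alpha * v `^ (alpha - 1) * expR (- u)] over [0 < v <= u] in both
orders: the inner integral in [v] is [u `^ alpha * expR (- u)], and the
inner integral in [u] is [alpha * v `^ (alpha - 1) * expR (- v)]. *)
Lemma eGammaD1 (R : realType) (alpha : R) : 0 < alpha ->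
  eGamma (alpha + 1) = (alpha%:E * eGamma alpha)%E.
Proof.
move=> alpha0.
pose g (u v : R) := expR (- u) * (alpha * v `^ (alpha - 1)).
pose f (z : R * R) : \bar R :=
  if (0 < z.2) && (z.2 <= z.1) then (g z.1 z.2)%:E else 0%E.
have g0 u v : 0 <= g u v by rewrite !mulr_ge0 ?expR_ge0 ?powR_ge0// ltW.
have f0 z : (0 <= f z)%E by rewrite /f; case: ifP => // _; rewrite lee_fin.
have mf : measurable_fun setT f.
  apply: measurable_fun_ifT => //.
  - apply: measurable_and; first exact: measurable_fun_ltr.
    exact: measurable_fun_ler.
  - apply/measurable_EFinP; apply: measurable_funM.
      apply: measurableT_comp; first exact: measurable_expR.
      exact: measurableT_comp.
    apply: measurable_funM => //.
    apply: (measurableT_comp (measurable_powR _)); exact: measurable_snd.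
have int_v u : (\int[lebesgue_measure]_v f (u, v))%E =
    (if 0 < u then (expR (- u) * u `^ (alpha + 1 - 1))%:E else 0%E).
  transitivity (\int[lebesgue_measure]_(v in `]0%R, u]) (g u v)%:E)%E.
    rewrite [RHS]integral_mkcond; apply: eq_integral => v _.
    by rewrite /f patchE mem_setE in_itv.
  case: ltP => [u0|u0]; last first.
    by rewrite set_itv_ge ?integral_set0// bnd_simp -leNgt.
  rewrite integral_itv_obnd_cbnd; last first.
    apply/measurable_EFinP/measurable_funTS; apply: measurable_funM => //.
    by apply: measurable_funM => //; exact: measurable_powR.
  under eq_integral.
    move=> v _; rewrite /g mulrA EFinM -[X in (X `^ _)%:E]subr0.
    over.
  rewrite ge0_integralZl_EFin//=.
  - rewrite integral_powR_subr ?ltW// subr0 -EFinM addrK.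
    by congr EFin; field; rewrite gt_eqF.
  - by move=> v _; rewrite lee_fin powR_ge0.
  - apply/measurable_EFinP/measurable_funTS.
    apply: (measurableT_comp (measurable_powR _)).
    exact: measurable_funB.
  - by rewrite mulr_ge0 ?expR_ge0 ?ltW.
have int_u v : (\int[lebesgue_measure]_u f (u, v))%E =
    (if (0 < v)%R then alpha%:E * (expR (- v) * v `^ (alpha - 1))%:E else 0)%E.
  case: ltP => [v0|v0]; last first.
    by rewrite integral0_eq// => u _; rewrite /f/= ltNge v0.
  transitivity (\int[lebesgue_measure]_(u in `[v, +oo[) (g u v)%:E)%E.
    rewrite [RHS]integral_mkcond; apply: eq_integral => u _.
    by rewrite /f patchE mem_setE in_itv/= v0 andbT.
  under eq_integral do rewrite /g (mulrC (expR _)) EFinM.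
  rewrite ge0_integralZl_EFin//=.
  - by rewrite integral_expRN_tail -!EFinM; congr EFin; ring.
  - apply/measurable_EFinP/measurable_funTS.
    by apply: measurableT_comp => //; exact: measurable_expR.
  - by rewrite mulr_ge0 ?powR_ge0 ?ltW.
transitivity (\int[lebesgue_measure]_u \int[lebesgue_measure]_v f (u, v))%E.
  rewrite /eGamma integral_mkcond; apply: eq_integral => u _.
  by rewrite int_v patchE mem_setE in_itv/= andbT.
rewrite [LHS](@fubini_tonelli _ _ _ _ R lebesgue_measure lebesgue_measure f)//.
transitivity (\int[lebesgue_measure]_(v in `]0%R, +oo[)
    (alpha%:E * (expR (- v) * v `^ (alpha - 1))%:E))%E.
  rewrite [RHS]integral_mkcond; apply: eq_integral => v _.
  by rewrite int_u patchE mem_setE in_itv/= andbT.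
rewrite ge0_integralZl_EFin//=.
- by move=> v _; rewrite lee_fin mulr_ge0 ?expR_ge0 ?powR_ge0.
- exact: measurable_eGamma_integrand.
- exact: ltW.
Qed.

(** For [alpha <= 1] the integrand is below [u `^ (alpha - 1)] up to [1] and
below [expR (- u)] beyond; the functional equation propagates finiteness from
arguments at most [n] to arguments at most [n + 1]. *)
Lemma eGamma_lty (R : realType) (alpha : R) : 0 < alpha ->
  (eGamma alpha < +oo)%E.
Proof.
move=> alpha0.
have [n] : exists n : nat, alpha <= n.+1%:R.
  exists (Num.bound alpha).
  by rewrite (le_trans (ltW (archi_boundP (ltW alpha0))))// ler_nat.
elim: n alpha alpha0 => [|n IH] alpha alpha0 alphan; last first.
  have [alpha1|alpha1] := leP alpha 1.
    by rewrite IH// (le_trans alpha1)// ler1n.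
  rewrite -(subrK 1 alpha) eGammaD1 ?subr_gt0//.
  rewrite lte_mul_pinfty//= ?lee_fin ?subr_ge0 1?ltW//.
  by rewrite IH ?subr_gt0// lerBlDr natr1.
rewrite /eGamma (@itv_bndbnd_setU _ _ _ (BRight 1)) ?bnd_simp//.
rewrite ge0_integral_setU//=; last 3 first.
- exact: measurable_eGamma_integrand.
- by move=> u _; rewrite lee_fin mulr_ge0 ?expR_ge0 ?powR_ge0.
- by apply/disj_setPS => u; rewrite /= !in_itv/=; lra.
apply: lte_add_pinfty.
- apply: (@le_lt_trans _ _ (\int[lebesgue_measure]_(u in `[0%R, 1%R])
     ((u - 0) `^ (alpha - 1))%:E)%E); last by rewrite integral_powR_subr ?ltry.
  rewrite -[leRHS]integral_itv_obnd_cbnd; last first.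
    apply/measurable_EFinP/measurable_funTS.
    apply: (measurableT_comp (measurable_powR _)).
    exact: measurable_funB.
  apply: ge0_le_integral => //=.
  - by move=> u _; rewrite lee_fin mulr_ge0 ?expR_ge0 ?powR_ge0.
  - exact: measurable_eGamma_integrand.
  - apply/measurable_EFinP/measurable_funTS.
    apply: (measurableT_comp (measurable_powR _)).
    exact: measurable_funB.
  - move=> u; rewrite in_itv/= => /andP[u0 _].
    by rewrite lee_fin subr0 ler_piMl ?powR_ge0// -expR0 ler_expR oppr_le0 ltW.
- apply: (@le_lt_trans _ _ (\int[lebesgue_measure]_(u in `[1%R, +oo[)
     (expR (- u))%:E)%E); last by rewrite integral_expRN_tail ltry.
  rewrite -[leRHS]integral_itv_obnd_cbnd; last first.
    apply/measurable_EFinP/measurable_funTS.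
    by apply: measurableT_comp => //; exact: measurable_expR.
  apply: ge0_le_integral => //=.
  - by move=> u _; rewrite lee_fin mulr_ge0 ?expR_ge0 ?powR_ge0.
  - exact: measurable_eGamma_integrand.
  - apply/measurable_EFinP/measurable_funTS.
    by apply: measurableT_comp => //; exact: measurable_expR.
  - move=> u; rewrite in_itv/= andbT => u1.
    rewrite lee_fin ler_piMr ?expR_ge0//.
    by rewrite -[leRHS](powRr0 u) ler_powR ?subr_le0// ltW.
Qed.

Lemma eGamma_gt0 (R : realType) (alpha : R) : 0 < alpha ->
  (0 < eGamma alpha)%E.
Proof.
move=> alpha0.
(* On [1, 2] the factor u `^ (alpha - 1) is at least u^-1, so at least 1/2. *)
pose c : R := expR (- 2) * 2^-1.
have c_le (u : R) : 1 <= u -> u <= 2 -> c <= expR (- u) * u `^ (alpha - 1).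
  move=> u1 u2; have u0 : 0 < u by exact: lt_le_trans u1.
  apply: ler_pM; rewrite ?expR_ge0 ?invr_ge0 ?ler_expR ?lerN2//.
  apply: (@le_trans _ _ (u `^ (-1))); last by rewrite ler_powR// lerDr ltW.
  by rewrite powR_inv1 ?lef_pV2 ?posrE// ltW.
apply: (@lt_le_trans _ _ (\int[lebesgue_measure]_(u in `[1%R, 2%R]) c%:E)%E).
  rewrite integral_cst//= lebesgue_measure_itv/= lte_fin ltr1n -EFinD.
  by rewrite -EFinM lte_fin !mulr_gt0 ?expR_gt0 ?invr_gt0// subr_gt0 ltr1n.
apply: (@le_trans _ _ (\int[lebesgue_measure]_(u in `[1%R, 2%R])
    (expR (- u) * u `^ (alpha - 1))%:E)%E).
  apply: ge0_le_integral => //=.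
  - by move=> u _; rewrite lee_fin mulr_ge0 ?expR_ge0.
  - exact: measurable_eGamma_integrand.
  - by move=> u; rewrite in_itv/= lee_fin => /andP[]; exact: c_le.
apply: ge0_subset_integral => //.
- exact: measurable_eGamma_integrand.
- by move=> u _; rewrite lee_fin mulr_ge0 ?expR_ge0 ?powR_ge0.
- by move=> u; rewrite /= !in_itv/=; lra.
Qed.

Lemma Gamma_gt0 (R : realType) (alpha : R) : 0 < alpha -> 0 < Gamma alpha.
Proof.
by move=> alpha0; apply: fine_gt0; rewrite eGamma_gt0//= eGamma_lty.
Qed.

Lemma GammaD1 (R : realType) (alpha : R) : 0 < alpha ->
  Gamma (alpha + 1) = alpha * Gamma alpha.
Proof.
move=> alpha0; rewrite /Gamma /Rintegral -!/(eGamma _) eGammaD1// fineM//.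
by rewrite ge0_fin_numE ?eGamma_lty// eGamma_ge0.
Qed.

(** * Lipschitz bound from the derivative *)

Lemma cvg_of_difference_quotient (R : realType) (f : R -> R) (c l : R)
    (u : nat -> R) : (forall n, u n != c) -> u n @[n --> \oo] --> c ->
  (u n - c)^-1 * (f (c + (u n - c)) - f c) @[n --> \oo] --> l ->
  f (u n) @[n --> \oo] --> f c.
Proof.
move=> uc ucvg ql.
have h0 : u n - c @[n --> \oo] --> 0.
  by rewrite -(subrr c); apply: cvgB => //; exact: cvg_cst.
have : f c + (u n - c) * ((u n - c)^-1 * (f (c + (u n - c)) - f c))
    @[n --> \oo] --> f c + 0 * l.
  by apply: cvgD; [exact: cvg_cst|exact: cvgM].
rewrite mul0r addr0; apply: cvg_trans; apply: near_eq_cvg.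
apply: nearW => n; rewrite mulrA divff ?mul1r ?subr_eq0//.
by rewrite !(addrC _ (_ - _)) !subrK.
Qed.

(** The one-sided derivatives at the endpoints are what makes [f] continuous up
to the boundary, so that the mean value theorem reaches [a] and [b]. *)
Lemma is_derivative_cc_continuous (R : realType) (a b : R) (f f' : R -> R) :
  a < b -> is_derivative_cc a b f f' -> {within `[a, b], continuous f}.
Proof.
move=> ab [dF da db]; apply/continuous_within_itvP => //; split.
- by move=> t /dF/is_derive_continuous.
- apply/cvg_at_rightP => u [ua ucvg].
  apply: (@cvg_of_difference_quotient _ _ _ (f' a)) => //.
    by move=> n; rewrite gt_eqF.
  move/cvg_at_rightP : da; apply; split; first by move=> n; rewrite subr_gt0.
  by rewrite -(subrr a); apply: cvgB => //; exact: cvg_cst.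
- apply/cvg_at_leftP => u [ub ucvg].
  apply: (@cvg_of_difference_quotient _ _ _ (f' b)) => //.
    by move=> n; rewrite lt_eqF.
  move/cvg_at_leftP : db; apply; split; first by move=> n; rewrite subr_lt0.
  by rewrite -(subrr b); apply: cvgB => //; exact: cvg_cst.
Qed.

Lemma is_derivative_cc_lipschitz (R : realType) (a b M : R) (f f' : R -> R) :
  a < b -> is_derivative_cc a b f f' ->
  (forall t, t \in `[a, b] -> `|f' t| <= M) ->
  forall u v, u \in `[a, b] -> v \in `[a, b] -> u <= v ->
    `|f v - f u| <= M * (v - u).
Proof.
move=> ab df hM u v uab vab uv.
have cf := is_derivative_cc_continuous ab df.
have sub t : t \in `[u, v] -> t \in `[a, b].
  by move: uab vab; rewrite !in_itv/=; lra.
have [| |c cuv ->] := @MVT_segment R f f' u v uv.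
- move=> t tuv; case: df => + _ _; apply.
  by move: uab vab tuv; rewrite !in_itv/=; lra.
- by apply: continuous_subspaceW cf => t /sub.
- rewrite normrM (@ger0_norm _ (v - u)) ?subr_ge0//.
  by rewrite ler_wpM2r ?subr_ge0// hM ?sub.
Qed.

(** * Deviation of weighted integrals *)

(** Both sides come from [c * w - w * f = w * (c - f)].  The last
function is dominated by [M * (w * r)], which makes [w * f] integrable too. *)
Lemma weighted_deviation (d : measure_display) (T : measurableType d)
    (R : realType) (mu : {measure set T -> \bar R}) (D : set T)
    (w r f : T -> R) (c M : R) :
  measurable D ->
  (forall t, D t -> 0 <= w t) ->
  mu.-integrable D (EFin \o w) ->
  mu.-integrable D (EFin \o (w \* r)) ->
  measurable_fun D f ->
  (forall t, D t -> `|c - f t| <= M * r t) ->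
  `|c * (\int[mu]_(t in D) w t)
    - \int[mu]_(t in D) (w t * f t)|
  <= M * \int[mu]_(t in D) (w t * r t).
Proof.
move=> mD w0 iw iwr mf cfr.
have mw : measurable_fun D w.
  by apply/measurable_EFinP; apply: measurable_int iw.
have iMwr : mu.-integrable D (EFin \o (fun t => M * (w t * r t))).
  by apply: (eq_integrable mD _ _ _ (integrableZl mD M iwr)) => // t _;
    rewrite /= EFinM.
have wd t : D t -> `|w t * (c - f t)| <= M * (w t * r t).
  move=> Dt; rewrite normrM (ger0_norm (w0 _ Dt)) mulrCA.
  by rewrite ler_wpM2l ?w0 ?cfr.
have id : mu.-integrable D (EFin \o (fun t => w t * (c - f t))).
  apply: (le_integrable mD _ _ iMwr).
    apply/measurable_EFinP; apply: measurable_funM => //.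
    exact: measurable_funB.
  by move=> t Dt; rewrite /= lee_fin (le_trans (wd _ Dt))// ler_norm.
have icw : mu.-integrable D (EFin \o (fun t => c * w t)).
  by apply: (eq_integrable mD _ _ _ (integrableZl mD c iw)) => // t _;
    rewrite /= EFinM.
have -> : \int[mu]_(t in D) (w t * f t) =
    c * (\int[mu]_(t in D) w t)
    - \int[mu]_(t in D) (w t * (c - f t)).
  rewrite -RintegralZl// -RintegralB//.
  by apply: eq_Rintegral => t _; ring.
rewrite opprB addrC subrK -RintegralZl//.
apply: le_trans (le_normr_Rintegral mD id) _.
by apply: le_Rintegral => //; exact: (integrable_norm id).
Qed.

(** The set [D] stands for an interval of length [L] ending at the point where
[f] equals [c], and [d] for the distance to its other end, so that [L - d] is
the distance to that point.  The integrals of powers of [d] are all that is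
needed of Lebesgue measure, which lets one proof serve both sides of the
point. *)
Lemma power_weight_deviation (disp : measure_display)
    (T : measurableType disp) (R : realType) (mu : {measure set T -> \bar R})
    (D : set T) (d f : T -> R) (L alpha c M : R) :
  measurable D -> 0 <= L -> 0 < alpha ->
  (forall r : R, 0 < r ->
    (\int[mu]_(t in D) (d t `^ (r - 1))%:E = (L `^ r / r)%:E)%E) ->
  measurable_fun D d ->
  (forall t, D t -> 0 <= d t) ->
  measurable_fun D f ->
  (forall t, D t -> `|c - f t| <= M * (L - d t)) ->
  `|L `^ alpha * c
    - alpha * \int[mu]_(t in D) (d t `^ (alpha - 1) * f t)|
  <= M / (alpha + 1) * L `^ (alpha + 1).
Proof.
move=> mD L0 al0 int_d md d0 mf cfd.
have power_moment r : 0 < r ->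
    mu.-integrable D (EFin \o (fun t => d t `^ (r - 1))) /\
    \int[mu]_(t in D) d t `^ (r - 1) = L `^ r / r.
  move=> r0; split; last by rewrite /Rintegral int_d.
  apply/integrableP; split.
    apply/measurable_EFinP.
    exact: (measurableT_comp (measurable_powR _) md).
  under eq_integral do rewrite /= ger0_norm ?powR_ge0//.
  by rewrite int_d ?ltry.
have al1 : 0 < alpha + 1 by rewrite addr_gt0.
have [iw Iw] := power_moment _ al0.
have [iw1 Iw1] := power_moment _ al1.
pose w t := d t `^ (alpha - 1).
(* The weighted distance is a difference of two consecutive powers of d. *)
have wrE : {in D, (fun t => L * w t - d t `^ (alpha + 1 - 1))
    =1 (fun t => w t * (L - d t))}.
  move=> t /set_mem/d0 dt0; rewrite addrK -(mulr_powRB1 dt0 al0) /w; ring.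
have iLw := integrableZl mD L iw.
have iwr : mu.-integrable D
    (EFin \o (fun t => w t * (L - d t))).
  apply: (eq_integrable mD _ _ _ (integrableB mD iLw iw1)) => //.
  by move=> t /wrE /= <-; rewrite EFinB EFinM.
have Iwr : \int[mu]_(t in D) (w t * (L - d t)) =
    L `^ (alpha + 1) / (alpha * (alpha + 1)).
  rewrite -(eq_Rintegral _ wrE) RintegralB// RintegralZl// Iw Iw1.
  rewrite -(@mulr_powRB1 _ L (alpha + 1)) // addrK.
  by field; rewrite !gt_eqF.
have := weighted_deviation mD (fun t _ => powR_ge0 _ _) iw iwr mf cfd.
rewrite Iw Iwr => dev.
have -> : L `^ alpha * c - alpha *
    \int[mu]_(t in D) (d t `^ (alpha - 1) * f t)
  = alpha * (c * (L `^ alpha / alpha) -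
    \int[mu]_(t in D) (d t `^ (alpha - 1) * f t)).
  by field; rewrite gt_eqF.
rewrite normrM (gtr0_norm al0).
apply: le_trans (ler_wpM2l (ltW al0) dev) _.
by rewrite le_eqVlt; apply/predU1P; left; field; rewrite !gt_eqF.
Qed.

(** * Comparison of the constants *)

(** A root form of Bernoulli's inequality, read off Young's inequality
[x * 1 <= x `^ p / p + 1 / q] at [x = (1 + p * alpha) `^ p^-1]. *)
Lemma powR_inv_le1D (R : realType) (p q alpha : R) :
  0 < p -> 0 < q -> p^-1 + q^-1 = 1 -> 0 <= alpha ->
  (1 + p * alpha) `^ p^-1 <= 1 + alpha.
Proof.
move=> p0 q0 pq al0.
have pal : 0 <= 1 + p * alpha by rewrite addr_ge0// mulr_ge0// ltW.
have := conjugate_powR (powR_ge0 (1 + p * alpha) p^-1) ler01 p0 q0 pq.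
rewrite mulr1 powR1 -powRrM mulVf ?gt_eqF// powRr1// => /le_trans; apply.
rewrite -[in leRHS]pq le_eqVlt; apply/predU1P; left.
by field; rewrite !gt_eqF.
Qed.

(** * The theorem *)

Theorem theorem8 (R : realType) (a b : R) (f f' : R -> R) (p q s M : R)
  (ha : 0 <= a) (hab : a < b)
  (hf : is_derivative_cc a b f f')
  (hint : lebesgue_measure.-integrable `[a, b] (EFin \o f'))
  (hp : 1 < p) (hq : 1 < q) (hpq : 1 / p + 1 / q = 1)
  (hs0 : 0 < s) (hs1 : s <= 1)
  (hconv : s_convex2 s `[a, b] (fun x => `|f' x| `^ q))
  (hM : forall x, x \in `[a, b] -> `|f' x| <= M)
  (alpha : R) (halpha : 0 < alpha) (x : R) (hx : x \in `[a, b]) :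
  `| ((x - a) `^ alpha + (b - x) `^ alpha) / (b - a) * f x
     - Gamma (alpha + 1) / (b - a)
       * (RL_minus alpha x f a + RL_plus alpha x f b) |
  <= M / (1 + p * alpha) `^ (1 / p) * (2 / (s + 1)) `^ (1 / q)
     * (((x - a) `^ (alpha + 1) + (b - x) `^ (alpha + 1)) / (b - a)).
Proof.
have p0 : 0 < p by exact: lt_trans hp.
have q0 : 0 < q by exact: lt_trans hq.
have ba0 : 0 < b - a by rewrite subr_gt0.
have M0 : 0 <= M.
  by apply: (le_trans (normr_ge0 _) (hM a _)); rewrite in_itv/= lexx ltW.
have /andP[ax xb] : a <= x <= b by rewrite in_itv in hx.
have mf : measurable_fun `[a, b] f.
  apply: subspace_continuous_measurable_fun => //.
  exact: is_derivative_cc_continuous hf.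
have lip := is_derivative_cc_lipschitz hab hf hM.
have left_dev : `|(x - a) `^ alpha * f x - alpha *
    \int[lebesgue_measure]_(t in `[a, x]) ((t - a) `^ (alpha - 1) * f t)|
    <= M / (alpha + 1) * (x - a) `^ (alpha + 1).
  apply: power_weight_deviation => //; rewrite ?subr_ge0//.
  - by move=> r r0; exact: integral_powR_subr.
  - by apply: measurable_funB.
  - by move=> t /=; rewrite in_itv/= subr_ge0 => /andP[].
  - apply: measurable_funS mf => //.
    by apply: subset_itvl; rewrite bnd_simp.
  - move=> t /=; rewrite in_itv/= => /andP[at_ tx].
    have -> : x - a - (t - a) = x - t by ring.
    by apply: lip => //; rewrite in_itv/= at_ (le_trans tx).
have right_dev : `|(b - x) `^ alpha * f x - alpha *
    \int[lebesgue_measure]_(t in `[x, b]) ((b - t) `^ (alpha - 1) * f t)|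
    <= M / (alpha + 1) * (b - x) `^ (alpha + 1).
  apply: power_weight_deviation => //; rewrite ?subr_ge0//.
  - by move=> r r0; exact: integral_powR_rsub.
  - by apply: measurable_funB.
  - by move=> t /=; rewrite in_itv/= subr_ge0 => /andP[].
  - apply: measurable_funS mf => //.
    by apply: subset_itvr; rewrite bnd_simp.
  - move=> t /=; rewrite in_itv/= => /andP[xt tb].
    have -> : b - x - (b - t) = t - x by ring.
    by rewrite distrC; apply: lip => //; rewrite in_itv/= tb (le_trans ax).
rewrite /RL_minus /RL_plus GammaD1//.
have G0 := Gamma_gt0 halpha.
move: left_dev right_dev.
set I1 := \int[lebesgue_measure]_(t in `[a, x]) ((t - a) `^ (alpha - 1) * f t).
set I2 := \int[lebesgue_measure]_(t in `[x, b]) ((b - t) `^ (alpha - 1) * f t).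
move=> left_dev right_dev.
have -> : ((x - a) `^ alpha + (b - x) `^ alpha) / (b - a) * f x
     - alpha * Gamma alpha / (b - a)
       * ((Gamma alpha)^-1 * I1 + (Gamma alpha)^-1 * I2)
  = (((x - a) `^ alpha * f x - alpha * I1)
     + ((b - x) `^ alpha * f x - alpha * I2)) / (b - a).
  by field; rewrite !gt_eqF.
rewrite normrM normfV (gtr0_norm ba0) [leRHS]mulrA ler_pM2r ?invr_gt0//.
apply: le_trans (ler_normD _ _) _.
apply: le_trans (lerD left_dev right_dev) _.
rewrite -mulrDr ler_wpM2r ?addr_ge0 ?powR_ge0//.
rewrite -mulrA ler_wpM2l//.
have bern : (1 + p * alpha) `^ (1 / p) <= alpha + 1.
  rewrite div1r [leRHS]addrC.
  by apply: (powR_inv_le1D p0 q0 _ (ltW halpha)); move: hpq; rewrite !div1r.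
have den0 : 0 < (1 + p * alpha) `^ (1 / p).
  by rewrite powR_gt0// addr_gt0// mulr_gt0.
have one_le : 1 <= (2 / (s + 1)) `^ (1 / q).
  have base_ge1 : 1 <= 2 / (s + 1).
    by rewrite ler_pdivlMr ?addr_gt0// mul1r; lra.
  rewrite -[leLHS](powRr0 (2 / (s + 1))).
  by apply: ler_powR => //; rewrite div1r invr_ge0 ltW.
apply: (@le_trans _ _ ((1 + p * alpha) `^ (1 / p))^-1).
  by rewrite lef_pV2 ?posrE// addr_gt0.
by rewrite ler_peMr// invr_ge0 ltW.
Qed.
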